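(* For every $\mathsf{e}\in\mathbf{O}_N$ one has $\mathsf{e}\,\mathsf{e}^\star\,\mathsf{e}=\mathsf{e}$. In particular $\mathbf{O}_N$ is a regular monoid.
   Context: The Okada monoid $\mathbf{O}_N$ is the monoid generated by $\mathsf{e}_1,\dots,\mathsf{e}_{N-1}$ with relations $\mathsf{e}_i^2=\mathsf{e}_i$ ($1\le i\le N-1$), $\mathsf{e}_i\mathsf{e}_j=\mathsf{e}_j\mathsf{e}_i$ ($|i-j|\ge 2$), $\mathsf{e}_{i+1}\mathsf{e}_i\mathsf{e}_{i+1}=\mathsf{e}_{i+1}$ ($1\le i\le N-2$). The map $\mathsf{e}\mapsto\mathsf{e}^\star$ is the anti-automorphism of $\mathbf{O}_N$ fixing each generator, i.e. $(\mathsf{e}_{i_1}\cdots\mathsf{e}_{i_k})^\star=\mathsf{e}_{i_k}\cdots\mathsf{e}_{i_1}$. A monoid is regular if for each element $x$ there is an element $y$ with $xyx=x$ and $yxy=y$. *)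

(* Defs.v *)
From HB Require Import structures.
From mathcomp Require Import all_boot.
From mathcomp Require Import boolp.

Set Implicit Arguments.
Unset Strict Implicit.
Unset Printing Implicit Defensive.

Local Open Scope group_scope.
Local Open Scope quotient_scope.

Definition regular_monoid (M : monoidType) : Prop :=
  forall x : M, exists y : M, x * y * x = x /\ y * x * y = y.

(* The generators e_1, ..., e_(N-1) are indexed from 0: the letter i : 'I_N.-1
   stands for e_(i+1). *)
Definition okada_word (N : nat) := seq 'I_N.-1.

Variant okada_rel (N : nat) : okada_word N -> okada_word N -> Prop :=
| OkadaIdem (i : 'I_N.-1) : okada_rel [:: i; i] [:: i]
| OkadaComm (i j : 'I_N.-1) of (i.+2 <= j)%N || (j.+2 <= i)%N :
    okada_rel [:: i; j] [:: j; i]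
| OkadaBraid (i j : 'I_N.-1) of j = i.+1 :> nat :
    okada_rel [:: j; i; j] [:: j].

Inductive okada_cong (N : nat) : okada_word N -> okada_word N -> Prop :=
| OkadaStep u v of okada_rel u v : okada_cong u v
| OkadaRefl u : okada_cong u u
| OkadaSym u v of okada_cong u v : okada_cong v u
| OkadaTrans u v w of okada_cong u v & okada_cong v w : okada_cong u w
| OkadaCat u u' v v' of okada_cong u u' & okada_cong v v' :
    okada_cong (u ++ v) (u' ++ v').

Section OkadaMonoid.
Variable N : nat.

Definition okada_congb : rel (okada_word N) := fun u v => `[< okada_cong u v >].

Lemma okada_congb_refl : reflexive okada_congb.
Proof. by move=> u; apply/asboolP/OkadaRefl. Qed.

Lemma okada_congb_sym : symmetric okada_congb.
Proof. by move=> u v; apply/asboolP/asboolP => /OkadaSym. Qed.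

Lemma okada_congb_trans : transitive okada_congb.
Proof.
by move=> v u w /asboolP uv /asboolP vw; apply/asboolP/(OkadaTrans uv vw).
Qed.

Canonical okada_equiv :=
  EquivRel okada_congb okada_congb_refl okada_congb_sym okada_congb_trans.

Definition okada := {eq_quot okada_equiv}.

HB.instance Definition _ := Choice.on okada.
HB.instance Definition _ := EqQuotient.on okada.

Lemma okada_eqP (u v : okada_word N) :
  \pi_okada u = \pi_okada v <-> okada_cong u v.
Proof. by split=> [/eqmodP/asboolP | uv] //; apply/eqmodP/asboolP. Qed.

Lemma okada_repr (u : okada_word N) : okada_cong (repr (\pi_okada u)) u.
Proof. by apply/okada_eqP; rewrite reprK. Qed.

Lemma okada_ind (P : okada -> Prop) :
  (forall u : okada_word N, P (\pi_okada u)) -> forall x, P x.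
Proof. exact: quotW. Qed.

Definition okada_one : okada := \pi_okada [::].
Definition okada_mul (x y : okada) : okada := \pi_okada (repr x ++ repr y).

Lemma okada_mul_pi u v :
  okada_mul (\pi_okada u) (\pi_okada v) = \pi_okada (u ++ v).
Proof. by apply/okada_eqP/OkadaCat; apply: okada_repr. Qed.

Lemma okada_mulA : associative okada_mul.
Proof.
elim/okada_ind=> u; elim/okada_ind=> v; elim/okada_ind=> w.
by rewrite !okada_mul_pi catA.
Qed.

Lemma okada_mul1 : left_id okada_one okada_mul.
Proof. by elim/okada_ind=> u; rewrite okada_mul_pi. Qed.

Lemma okada_mulr1 : right_id okada_one okada_mul.
Proof. by elim/okada_ind=> u; rewrite okada_mul_pi cats0. Qed.

HB.instance Definition _ :=
  isMonoid.Build okada okada_mulA okada_mul1 okada_mulr1.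

Definition okada_gen (i : 'I_N.-1) : okada := \pi_okada [:: i].

Lemma okada_piM (u v : okada_word N) :
  \pi_okada u * \pi_okada v = \pi_okada (u ++ v).
Proof. exact: okada_mul_pi. Qed.

Lemma okada_pi_prod (u : okada_word N) :
  \pi_okada u = \prod_(i <- u) okada_gen i.
Proof.
elim: u => [|i u IHu]; first by rewrite big_nil.
by rewrite big_cons -IHu okada_piM.
Qed.

Lemma okada_rev_cong (u v : okada_word N) :
  okada_cong u v -> okada_cong (rev u) (rev v).
Proof.
elim=> {u v} [u v []|||u v w _ uv _ vw|u u' v v' _ uu' _ vv'].
- by move=> i; apply/OkadaStep/OkadaIdem.
- by move=> i j ij; apply/OkadaStep/OkadaComm; rewrite orbC.
- by move=> i j ij; apply/OkadaStep/OkadaBraid.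
- by move=> u; apply: OkadaRefl.
- by move=> u v _; apply: OkadaSym.
- exact: OkadaTrans uv vw.
- by rewrite !rev_cat; apply: OkadaCat.
Qed.

Definition okada_star (x : okada) : okada := \pi_okada (rev (repr x)).

Lemma okada_star_pi (u : okada_word N) :
  okada_star (\pi_okada u) = \pi_okada (rev u).
Proof. by apply/okada_eqP/okada_rev_cong/okada_repr. Qed.

Lemma okada_star_gen i : okada_star (okada_gen i) = okada_gen i.
Proof. exact: okada_star_pi. Qed.

Lemma okada_star1 : okada_star 1 = 1.
Proof. exact: okada_star_pi. Qed.

Lemma okada_starM (x y : okada) :
  okada_star (x * y) = okada_star y * okada_star x.
Proof.
elim/okada_ind: x => u; elim/okada_ind: y => v.
by rewrite okada_piM !okada_star_pi okada_piM rev_cat.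
Qed.

Lemma okada_starK : involutive okada_star.
Proof. by elim/okada_ind=> u; rewrite !okada_star_pi revK. Qed.

Lemma okada_star_prod (u : okada_word N) :
  okada_star (\prod_(i <- u) okada_gen i) = \prod_(i <- rev u) okada_gen i.
Proof. by rewrite -!okada_pi_prod okada_star_pi. Qed.

Lemma okada_gen_idem i : okada_gen i * okada_gen i = okada_gen i.
Proof. by rewrite okada_piM; apply/okada_eqP/OkadaStep/OkadaIdem. Qed.

Lemma okada_gen_comm (i j : 'I_N.-1) : (i.+2 <= j)%N || (j.+2 <= i)%N ->
  okada_gen i * okada_gen j = okada_gen j * okada_gen i.
Proof.
by move=> ij; rewrite !okada_piM; apply/okada_eqP/OkadaStep/OkadaComm.
Qed.

Lemma okada_gen_braid (i j : 'I_N.-1) : j = i.+1 :> nat ->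
  okada_gen j * okada_gen i * okada_gen j = okada_gen j.
Proof.
by move=> ij; rewrite /okada_gen !okada_piM; apply/okada_eqP/OkadaStep/OkadaBraid.
Qed.

Lemma okada_gen_generate (x : okada) :
  exists u : okada_word N, x = \prod_(i <- u) okada_gen i.
Proof. by elim/okada_ind: x => u; exists u; apply: okada_pi_prod. Qed.

End OkadaMonoid.

(* Main.v *)
Require Import Defs.
From mathcomp Require Import all_boot.

(** Write e_i for the generators and O_m for the submonoid generated by the
    e_i with i < m, and let e = e_i, f = e_(i-1).  The relations e_i e_i = e_i
    and e f e = e allow the largest generator of a word to be used at most
    once: between two consecutive occurrences of e there is a word of O_i,
    which by induction contains f at most once, and every other letter of it
    commutes with e ([below_top_split]).  Repeating this to the right of the
    largest letter, every x in O_(i+1) outside O_i is x = u d with u in O_i and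
    d = e_i e_(i-1) ... e_k a descending run.  Such a run telescopes:
    d d^* = e_i ([below_top_run]).

    The identity x x^* x = x then goes by induction on the number of generators
    available.  For x = u d it reads (u e u^* u e) d = u d, so it suffices that
    u e u^* u e = u e for u in O_i ([below_mul_top]).  The mirror image of the
    decomposition, applied to u, gives u = a q with q in O_(i-1), which commutes
    with e, and a^* a = f; hence
      u e u^* u e = a q e q^* f q e = a q q^* (e f e) q = (a q q^* q) e = u e,
    by the induction hypothesis on q.  Regularity follows with y = x^*. *)

Set Implicit Arguments.
Unset Strict Implicit.
Unset Printing Implicit Defensive.

Local Open Scope group_scope.

Lemma ord_chain_ind n (P : 'I_n -> Prop) :
    (forall i : 'I_n, i = 0 :> nat -> P i) ->
    (forall i j : 'I_n, i = j.+1 :> nat -> P j -> P i) ->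
  forall i, P i.
Proof.
move=> P0 PS [m ltmn]; elim: m ltmn => [|m IHm] ltmn; first exact: P0.
exact: PS (IHm (ltnW ltmn)).
Qed.

Section Okada.
Variable N : nat.
Implicit Types (m : nat) (i j : 'I_N.-1) (x y u v d : okada N).

Local Notation gen := (@okada_gen N).
Local Notation star := (@okada_star N).

(** Membership in O_m.  It is built by adding letters on the left, so that an
    element is treated by induction without choosing a word for it. *)
Inductive below m : okada N -> Prop :=
| Below1 : below m 1
| BelowM i x of i < m & below m x : below m (gen i * x).

Lemma below_mul m x y : below m x -> below m y -> below m (x * y).
Proof.
move=> bx by_; elim: bx => [|i {}x im _ IHx]; first by rewrite mul1g.
by rewrite -mulgA; apply: BelowM.
Qed.

Lemma below_gen m i : i < m -> below m (gen i).
Proof. by move=> im; rewrite -[gen i]mulg1; apply: BelowM => //; apply: Below1. Qed.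

Lemma below_star m x : below m x -> below m (star x).
Proof.
elim=> [|i {}x im _ IHx]; first by rewrite okada_star1; apply: Below1.
by rewrite okada_starM okada_star_gen; apply: below_mul => //; apply: below_gen.
Qed.

Lemma below_leq m p x : m <= p -> below m x -> below p x.
Proof.
move=> mp; elim=> [|i {}x im _ IHx]; first exact: Below1.
by apply: BelowM => //; apply: leq_trans mp.
Qed.

Lemma below0 x : below 0 x -> x = 1.
Proof. by case. Qed.

Lemma below_full x : below N.-1 x.
Proof.
have [w ->] := okada_gen_generate x.
by elim: w => [|i w IHw]; rewrite ?big_nil ?big_cons; [apply: Below1|apply: BelowM].
Qed.

Lemma below_comm m j x : m < j -> below m x -> gen j * x = x * gen j.
Proof.
move=> mj; elim=> [|i {}x im _ IHx]; first by rewrite mulg1 mul1g.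
rewrite mulgA (@okada_gen_comm N j i) ?(leq_trans _ mj) ?orbT //.
by rewrite -!mulgA IHx.
Qed.

(** The relation [e f e = e] in context: everything below [f] commutes with
    [e], so the two copies of [e] can be brought next to [f]. *)
Lemma gen_mul_below_gen i j x y : i = j.+1 :> nat -> below j x -> below j y ->
  gen i * (x * gen j * y) * gen i = x * y * gen i.
Proof.
move=> ij bx by_; have ji : j < i by rewrite ij.
rewrite -!mulgA -(below_comm ji by_) !mulgA (below_comm ji bx).
by rewrite -(mulgA x _ (gen j)) -(mulgA x (gen i * gen j)) okada_gen_braid.
Qed.

(** The largest letter need not occur twice: in [e u e], the inner [u] has, by
    the same statement one index lower, at most one letter that fails to commute
    with [e], and that letter is absorbed by the relation [e f e = e]. *)
Lemma below_top_split i x : below i.+1 x ->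
  below i x \/ exists u v, [/\ below i u, below i v & x = u * gen i * v].
Proof.
elim/ord_chain_ind: i x => [i i0 | i j ij IHj] x.
(* Add a letter [e_k] on the left: for [k < i] it joins the left factor, and
   only [k = i] can create a second occurrence of [e_i]. *)
all: elim=> [|k {}x ki _ IHx]; first by left; apply: Below1.
all: move: ki; rewrite ltnS leq_eqVlt => /orP[/eqP/val_inj -> | ki]; last first.
1,3: case: IHx => [bx | [u [v [bu bv ->]]]]; first by left; apply: BelowM.
1,2: by right; exists (gen k * u), v; split; rewrite ?mulgA //; apply: BelowM.
all: right; case: IHx => [bx | [u [v [bu bv ->]]]].
1,3: by exists 1, x; split; rewrite ?mul1g //; apply: Below1.
- exists 1, v; split; rewrite ?mul1g //; first exact: Below1.
  by move: bu; rewrite i0 => /below0 ->; rewrite mul1g mulgA okada_gen_idem.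
have ji : j < i by rewrite ij.
move: (bu); rewrite {1}ij => /IHj [bju | [a [b [ba bb Eu]]]].
  exists u, v; split=> //.
  by rewrite !mulgA (below_comm ji bju) -(mulgA u) okada_gen_idem.
have bi z : below j z -> below i z by apply: below_leq; apply: ltnW.
exists (a * b), v; split=> //; first by apply: below_mul; apply: bi.
by rewrite Eu 2!mulgA (gen_mul_below_gen ij ba bb) -!mulgA.
Qed.

(** Here [d] is a descending run [e_i e_(i-1) ... e_k]; only the two equations
    it satisfies matter.  It is built by moving to the left of [e_i] everything
    that commutes with it, and its product with its mirror image collapses from
    the middle outwards. *)
Lemma below_top_run i x : below i.+1 x ->
  below i x \/ exists u d,
    [/\ below i u, gen i * d = d, d * star d = gen i & x = u * d].
Proof.
have run1 j : gen j * gen j = gen j /\ gen j * star (gen j) = gen j.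
  by rewrite okada_star_gen okada_gen_idem.
elim/ord_chain_ind: i x => [i i0 | i j ij IHj] x /below_top_split.
all: case=> [bx | [u [v [bu bv ->]]]]; [by left | right].
all: have [run_l run_star] := run1 i.
- move: bv; rewrite {1}i0 => /below0 ->.
  by exists u, (gen i); split; rewrite ?mulg1.
have ji : j < i by rewrite ij.
have bi z : below j z -> below i z by apply: below_leq; apply: ltnW.
move: bv; rewrite {1}ij => /IHj [bv | [w [d [bw _ dd ->]]]].
  exists (u * v), (gen i); split=> //; first by apply: below_mul => //; apply: bi.
  by rewrite -mulgA (below_comm ji bv) mulgA.
exists (u * w), (gen i * d); split.
- by apply: below_mul => //; apply: bi.
- by rewrite mulgA okada_gen_idem.
- rewrite okada_starM okada_star_gen !mulgA -(mulgA (gen i)) dd.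
  exact: okada_gen_braid.
by rewrite !mulgA -(mulgA u) (below_comm ji bw) !mulgA.
Qed.

(** The mirror image of the previous decomposition writes [u] as [a q], with [a]
    an ascending run ending in the letter just under [e_i].  The factor [q] and
    its mirror image can thus be moved out of the way of the relation
    [e f e = e]. *)
Lemma below_mul_top i u :
    (forall m x, m <= i -> below m x -> x * star x * x = x) ->
  below i u -> u * gen i * star u * u * gen i = u * gen i.
Proof.
move=> IH; elim/ord_chain_ind: i IH => [i i0 | i j ij _] IH bu.
  move: bu; rewrite i0 => /below0 ->.
  by rewrite okada_star1 !mulg1 !mul1g okada_gen_idem.
have ji : j < i by rewrite ij.
have : below j.+1 (star u) by rewrite -ij; apply: below_star.
case/below_top_run => [/below_star | [q [a [bq _ aa Eu]]]].
  rewrite okada_starK => bju; rewrite -(mulgA u).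
  rewrite (below_comm ji (below_star bju)) !mulgA -(mulgA _ (gen i) u).
  by rewrite (below_comm ji bju) !mulgA (IH _ _ (ltnW ji) bju) -mulgA okada_gen_idem.
have bq' := below_star bq.
have Eu' : u = star a * star q by rewrite -okada_starM -Eu okada_starK.
have -> : u * gen i * star u * u * gen i =
    star a * star q * (gen i * (q * (a * star a) * star q) * gen i).
  by rewrite Eu Eu' !mulgA.
rewrite aa (gen_mul_below_gen ij bq bq') Eu' !mulgA -2!(mulgA (star a)).
by have := IH _ _ (ltnW ji) bq'; rewrite okada_starK => ->.
Qed.

Lemma below_mul_star m x : m <= N.-1 -> below m x -> x * star x * x = x.
Proof.
elim/ltn_ind: m x => [[|m]] IHm x mN bx.
  by rewrite (below0 bx) okada_star1 !mulg1.
pose i := Ordinal mN.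
have IHi p y : p <= i -> below p y -> y * star y * y = y.
  by move=> pi; apply: IHm; rewrite ?ltnS // (leq_trans pi) // ltnW.
case: (@below_top_run i x bx) => [/IHi -> // | [u [d [bu ed dd ->]]]].
have -> : u * d * star (u * d) * (u * d) = u * (d * star d) * star u * u * d.
  by rewrite okada_starM !mulgA.
by rewrite dd -{1}ed mulgA (below_mul_top IHi bu) -mulgA ed.
Qed.

Lemma okada_mul_star x : x * star x * x = x.
Proof. exact: below_mul_star (leqnn _) (below_full x). Qed.

End Okada.

Theorem corollary5p10 (N : nat) :
  (forall e : okada N, e * okada_star e * e = e) /\
  regular_monoid (okada N).
Proof.
split=> [e | x]; first exact: okada_mul_star.
exists (okada_star x); split; first exact: okada_mul_star.
by have := okada_mul_star (okada_star x); rewrite okada_starK.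
Qed.
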